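(* Let $S$ be a $\Gamma$-semiring which has a left unity and a right unity, and let $R$ be its right operator semiring. For a fuzzy subset $\sigma$ of $S$ let $\sigma^{*'}$ be the fuzzy subset of $R$ given by $\sigma^{*'}(\sum_i[\alpha_i,x_i])=\inf_{a\in S}\sigma(\sum_i a\alpha_i x_i)$, and for a fuzzy subset $\mu$ of $R$ let $\mu^{*}$ be the fuzzy subset of $S$ given by $\mu^{*}(a)=\inf_{\alpha\in\Gamma}\mu([\alpha,a])$. Then: (1) if $\sigma$ is a fuzzy $k$-ideal of $S$, then $\sigma^{*'}$ is a fuzzy $k$-ideal of $R$; (2) if $\mu$ is a fuzzy $k$-ideal of $R$, then $\mu^{*}$ is a fuzzy $k$-ideal of $S$.
   Context: $\Gamma$-semiring: $S$ and $\Gamma$ are (nonempty) additive commutative semigroups with a map $S\times\Gamma\times S\to S$, $(a,\alpha,b)\mapsto a\alpha b$, such that $a\alpha(b+c)=a\alpha b+a\alpha c$, $(a+b)\alpha c=a\alpha c+b\alpha c$, $a(\alpha+\beta)c=a\alpha c+a\beta c$, $a\alpha(b\beta c)=(a\alpha b)\beta c$ for all $a,b,c\in S$, $\alpha,\beta\in\Gamma$. No zero elements are assumed. Right operator semiring $R$: let $G$ be the free additive commutative semigroup generated by $\Gamma\times S$ (finite nonempty formal sums). Identify $\sum_i(\alpha_i,x_i)$ with $\sum_j(\beta_j,y_j)$ iff $\sum_i a\alpha_i x_i=\sum_j a\beta_j y_j$ for all $a\in S$; this is a congruence on $G$. The class of $\sum_i(\alpha_i,x_i)$ is written $\sum_i[\alpha_i,x_i]$.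 $R$ is the quotient, with the induced addition and the multiplication $(\sum_i[\alpha_i,x_i])(\sum_j[\beta_j,y_j])=\sum_{i,j}[\alpha_i,x_i\beta_j y_j]$; it is a semiring. Unities: a right unity of $S$ is a finite sum $\sum_j[\gamma_j,f_j]\in R$ with $\sum_j a\gamma_j f_j=a$ for all $a\in S$. A left unity of $S$ is given by finitely many $e_i\in S$, $\delta_i\in\Gamma$ with $\sum_i e_i\delta_i a=a$ for all $a\in S$. A fuzzy subset of a set $X$ is a function $X\to[0,1]$. A fuzzy subset $\mu$ of $S$ is a fuzzy ideal of $S$ if $\mu(a+b)\ge\min(\mu(a),\mu(b))$, $\mu(a\alpha b)\ge\mu(a)$ and $\mu(a\alpha b)\ge\mu(b)$ for all $a,b\in S$, $\alpha\in\Gamma$. A fuzzy subset $\mu$ of $R$ is a fuzzy ideal of $R$ if $\mu(p+q)\ge\min(\mu(p),\mu(q))$, $\mu(pq)\ge\mu(p)$ and $\mu(pq)\ge\mu(q)$ for all $p,q\in R$. A fuzzy ideal $\mu$ (of $S$ or of $R$) is a fuzzy $k$-ideal if $\mu(x)\ge\min(\mu(x+y),\mu(y))$ for all $x,y$ (in $S$, respectively in $R$). *)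

(* Defs.v *)
From HB Require Import structures.
From mathcomp Require Import all_boot all_order all_algebra.
From mathcomp Require Import generic_quotient finmap multiset.
From mathcomp Require Import mathcomp_extra boolp classical_sets reals.

Set Implicit Arguments.
Unset Strict Implicit.
Unset Printing Implicit Defensive.

Import Order.TTheory GRing.Theory Num.Theory.

Local Open Scope mset_scope.
Local Open Scope quotient_scope.
Local Open Scope ring_scope.

Section Sum1.
Variable V : addSemigroupType.

(* V has no zero, so only nonempty sequences can be summed. *)
Definition sum1 (s : seq V) : (0 < size s)%N -> V :=
  match s with
  | [::] => fun s_gt0 => False_rect V (notF s_gt0)
  | x :: s' => fun _ => foldl +%R x s'
  end.

Let oadd := oAC (@Algebra.addrA V) (@Algebra.addrC V).

Lemma sum1E (s : seq V) (s_gt0 : (0 < size s)%N) :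
  Some (sum1 s_gt0) = \big[oadd/None]_(x <- s) Some x.
Proof.
case: s s_gt0 => //= x s _; rewrite big_cons.
elim: s x => [|y s IHs] x /=; first by rewrite big_nil.
rewrite IHs big_cons; case: (\big[_/_]_(_ <- _) _) => //= z.
by rewrite /oadd !oACE Algebra.addrA.
Qed.

Lemma sum1_perm (s t : seq V) (s_gt0 : (0 < size s)%N)
    (t_gt0 : (0 < size t)%N) :
  perm_eq s t -> sum1 s_gt0 = sum1 t_gt0.
Proof. by move=> st; apply: Some_inj; rewrite !sum1E (perm_big _ st). Qed.

Lemma sum1_cat (s t u : seq V) (s_gt0 : (0 < size s)%N)
    (t_gt0 : (0 < size t)%N) (u_gt0 : (0 < size u)%N) :
  perm_eq u (s ++ t) -> sum1 u_gt0 = sum1 s_gt0 + sum1 t_gt0.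
Proof.
move=> ust; apply: Some_inj.
by rewrite sum1E (perm_big _ ust) big_cat -!sum1E.
Qed.

End Sum1.

(* The free commutative semigroup on T: nonempty finite multisets. *)
Definition freeCSemigroup (T : choiceType) :=
  {m : {mset T} | (0 < size m)%N}.

HB.instance Definition _ (T : choiceType) := SubChoice.on (freeCSemigroup T).

Section FreeCSemigroup.
Variable T : choiceType.
Implicit Types (x y : T) (m n : freeCSemigroup T).

Definition fcs_mset m : {mset T} := val m.

Lemma perm_msetD (A B : {mset T}) : perm_eq (msetD A B) (A ++ B).
Proof.
by apply/allP => x _ /=; rewrite count_cat !count_mem_mset msetE2.
Qed.

Fact fcs_gen_subproof x : (0 < size (msetn 1 x))%N.
Proof. by rewrite enum_msetn. Qed.

Definition fcs_gen x : freeCSemigroup T := Sub (msetn 1 x) (fcs_gen_subproof x).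

Fact fcs_add_subproof m n : (0 < size (msetD (fcs_mset m) (fcs_mset n)))%N.
Proof. by rewrite (perm_size (perm_msetD _ _)) size_cat addn_gt0 (valP m). Qed.

Definition fcs_add m n : freeCSemigroup T :=
  Sub (msetD (fcs_mset m) (fcs_mset n)) (fcs_add_subproof m n).

Fact fcs_addC : commutative fcs_add.
Proof. by move=> m n; apply: val_inj; rewrite /= msetDC. Qed.

Fact fcs_addA : associative fcs_add.
Proof. by move=> m n p; apply: val_inj; rewrite /= msetDA. Qed.

HB.instance Definition _ :=
  Algebra.isAddSemigroup.Build (freeCSemigroup T) fcs_addC fcs_addA.

Lemma fcs_ind (P : freeCSemigroup T -> Prop) :
    (forall x, P (fcs_gen x)) -> (forall m n, P m -> P n -> P (m + n)) ->
  forall m, P m.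
Proof.
move=> Pgen Padd.
suff Pseq (s : seq T) m : perm_eq (fcs_mset m) s -> P m.
  by move=> m; apply: (Pseq (fcs_mset m)).
elim: s m => [|x s IHs] m ms.
  by have := valP m; rewrite (perm_size ms).
have [s0|s_gt0] := posnP (size s).
  suff -> : m = fcs_gen x by [].
  apply: val_inj; apply/msetP => y /=.
  rewrite -!count_mem_mset (permP ms) enum_msetn.
  by rewrite (size0nil s0).
have sP : (0 < size (seq_mset s))%N by rewrite (perm_size (perm_eq_seq_mset _)).
pose n : freeCSemigroup T := Sub (seq_mset s) sP.
suff -> : m = fcs_gen x + n by apply: Padd => //; apply/IHs/perm_eq_seq_mset.
apply: val_inj; apply/msetP => y /=.
by rewrite mset1DE mset_seqE -count_mem_mset (permP ms) /= eq_sym.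
Qed.

Section Sum.
Variable V : addSemigroupType.
Implicit Type f : T -> V.

Fact fcs_sum_subproof f m : (0 < size [seq f x | x <- fcs_mset m])%N.
Proof. by rewrite size_map (valP m). Qed.

(* The sum of the values of f over the formal sum m, i.e. the extension of f  *)
(* to a morphism of semigroups.                                               *)
Definition fcs_sum f m : V := sum1 (fcs_sum_subproof f m).

Lemma fcs_sum_gen f x : fcs_sum f (fcs_gen x) = f x.
Proof.
by rewrite -[RHS](@erefl _ (sum1 (s := [:: f x]) isT)); apply: sum1_perm;
  rewrite /= enum_msetn.
Qed.

Lemma fcs_sumD f : {morph fcs_sum f : m n / m + n}.
Proof.
by move=> m n; apply: sum1_cat; rewrite -map_cat; apply/perm_map/perm_msetD.
Qed.

Lemma eq_fcs_sum f g m : f =1 g -> fcs_sum f m = fcs_sum g m.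
Proof.
move=> fg; elim/fcs_ind: m => [x|m n IHm IHn].
  by rewrite !fcs_sum_gen.
by rewrite !fcs_sumD IHm IHn.
Qed.

Lemma fcs_sum_split f g m :
  fcs_sum (fun x => f x + g x) m = fcs_sum f m + fcs_sum g m.
Proof.
elim/fcs_ind: m => [x|m n IHm IHn]; first by rewrite !fcs_sum_gen.
by rewrite !fcs_sumD IHm IHn !Algebra.addrA [_ + _ + fcs_sum f n]Algebra.addrAC.
Qed.

End Sum.

Lemma fcs_sum_morph (V W : addSemigroupType) (h : V -> W) (f : T -> V) m :
  {morph h : x y / x + y} -> h (fcs_sum f m) = fcs_sum (fun x => h (f x)) m.
Proof.
move=> hD; elim/fcs_ind: m => [x|m n IHm IHn].
  by rewrite !fcs_sum_gen.
by rewrite !fcs_sumD hD IHm IHn.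
Qed.

End FreeCSemigroup.

(* Semirings need not have a zero or a one, unlike MathComp's. The product is *)
(* that of semigroupType, in group_scope.                                     *)
HB.mixin Record isDistributive R
    of Algebra.AddSemigroup R & Semigroup R := {
  mulgDl : left_distributive (@monoid.mul R) (@Algebra.add R);
  mulgDr : right_distributive (@monoid.mul R) (@Algebra.add R)
}.

#[short(type="zerolessSemiringType")]
HB.structure Definition ZerolessSemiring :=
  {R of isDistributive R & Algebra.AddSemigroup R & Semigroup R}.

Record gammaSemiring := GammaSemiring {
  gs_car :> addSemigroupType;
  gs_gam : addSemigroupType;
  gmul : gs_car -> gs_gam -> gs_car -> gs_car;
  gs_car_inh : inhabited gs_car;
  gs_gam_inh : inhabited gs_gam;
  gmulDr : forall a al b c, gmul a al (b + c) = gmul a al b + gmul a al c;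
  gmulDl : forall a b al c, gmul (a + b) al c = gmul a al c + gmul b al c;
  gmulDm : forall a al be c, gmul a (al + be) c = gmul a al c + gmul a be c;
  gmulA : forall a al b be c,
    gmul a al (gmul b be c) = gmul (gmul a al b) be c
}.

Section RightOperatorSemiring.
Variable S : gammaSemiring.
Local Notation Gam := (gs_gam S).
Local Notation G := (freeCSemigroup (Gam * S)%type).
Implicit Types (a b x : S) (g h : G).

(* For g = sum_i (al_i, x_i): the element sum_i (a al_i x_i) of S. *)
Definition formal_act a g : S := fcs_sum (fun p => gmul a p.1 p.2) g.

(* sum_(i, j) (al_i, x_i be_j y_j) *)
Definition formal_mul g h : G :=
  fcs_sum (fun p => fcs_sum (fun q => fcs_gen (p.1, gmul p.2 q.1 q.2)) h) g.

Lemma formal_actDl a b g :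
  formal_act (a + b) g = formal_act a g + formal_act b g.
Proof.
by rewrite -fcs_sum_split; apply: eq_fcs_sum => p; rewrite gmulDl.
Qed.

Lemma formal_actD a : {morph formal_act a : g h / g + h}.
Proof. exact: fcs_sumD. Qed.

Lemma formal_act_mul a g h :
  formal_act a (formal_mul g h) = formal_act (formal_act a g) h.
Proof.
rewrite /formal_mul (fcs_sum_morph _ _ (formal_actD a)).
rewrite [formal_act a g]/formal_act.
rewrite (@fcs_sum_morph _ _ _ (formal_act^~ h)); last first.
  by move=> x y; apply: formal_actDl.
apply: eq_fcs_sum => p; rewrite (fcs_sum_morph _ _ (formal_actD a)).
by apply: eq_fcs_sum => q; rewrite /formal_act fcs_sum_gen gmulA.
Qed.

Definition opeq g h := `[< forall a, formal_act a g = formal_act a h >].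

Fact opeq_refl : reflexive opeq. Proof. by move=> g; apply/asboolP. Qed.

Fact opeq_sym : ssrbool.symmetric opeq.
Proof. by move=> g h; apply/asboolP/asboolP => gh a; rewrite gh. Qed.

Fact opeq_trans : ssrbool.transitive opeq.
Proof.
by move=> h g k /asboolP gh /asboolP hk; apply/asboolP => a; rewrite gh hk.
Qed.

Canonical opeq_equiv := EquivRel opeq opeq_refl opeq_sym opeq_trans.

Definition rightOp := {eq_quot opeq}.

HB.instance Definition _ := Choice.on rightOp.

Implicit Types p q r : rightOp.

(* For g = sum_i (al_i, x_i): its class sum_i [al_i, x_i]. *)
Definition opcls g : rightOp := \pi_({eq_quot opeq}) g.

Definition oprepr p : G := repr (p : {eq_quot opeq}).

Lemma opreprK p : opcls (oprepr p) = p.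
Proof. exact: reprK. Qed.

(* [al, x] *)
Definition opgen (al : Gam) x : rightOp := opcls (fcs_gen (al, x)).

(* For p = sum_i [al_i, x_i]: the element sum_i (a al_i x_i) of S. *)
Definition opact a p : S := formal_act a (oprepr p).

Lemma opcls_eqP g h :
  opcls g = opcls h <-> forall a, formal_act a g = formal_act a h.
Proof.
by split=> [/eqmodP/asboolP //|gh]; apply/eqmodP/asboolP.
Qed.

Lemma opact_cls a g : opact a (opcls g) = formal_act a g.
Proof. by apply: (opcls_eqP _ _).1; rewrite opreprK. Qed.

Lemma opact_inj p q : (forall a, opact a p = opact a q) -> p = q.
Proof. by move=> pq; rewrite -[p]opreprK -[q]opreprK; apply/opcls_eqP. Qed.

Definition opadd p q : rightOp := opcls (oprepr p + oprepr q).

Definition opmul p q : rightOp := opcls (formal_mul (oprepr p) (oprepr q)).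

Lemma opcls_add g h : opadd (opcls g) (opcls h) = opcls (g + h).
Proof.
by apply/opcls_eqP => a; rewrite !formal_actD -!/(opact a _) !opact_cls.
Qed.

Lemma opcls_mul g h : opmul (opcls g) (opcls h) = opcls (formal_mul g h).
Proof.
apply/opcls_eqP => a.
by rewrite !formal_act_mul -/(opact _ _) opact_cls -/(opact _ _) opact_cls.
Qed.

Lemma opact_add a p q : opact a (opadd p q) = opact a p + opact a q.
Proof. by rewrite opact_cls formal_actD. Qed.

Lemma opact_mul a p q : opact a (opmul p q) = opact (opact a p) q.
Proof. by rewrite opact_cls formal_act_mul. Qed.

Lemma opactDl a b p : opact (a + b) p = opact a p + opact b p.
Proof. exact: formal_actDl. Qed.

Fact opaddC : commutative opadd.
Proof.
by move=> p q; apply: opact_inj => a; rewrite !opact_add Algebra.addrC.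
Qed.

Fact opaddA : associative opadd.
Proof.
by move=> p q r; apply: opact_inj => a; rewrite !opact_add Algebra.addrA.
Qed.

Fact opmulA : associative opmul.
Proof. by move=> p q r; apply: opact_inj => a; rewrite !opact_mul. Qed.

HB.instance Definition _ := Algebra.isAddSemigroup.Build rightOp opaddC opaddA.
HB.instance Definition _ := hasMul.Build rightOp opmul.
HB.instance Definition _ := Magma_isSemigroup.Build rightOp opmulA.

Fact opmulDl : left_distributive (@monoid.mul rightOp) (@Algebra.add rightOp).
Proof.
by move=> p q r; apply: opact_inj => a; rewrite !(opact_mul, opact_add) opactDl.
Qed.

Fact opmulDr : right_distributive (@monoid.mul rightOp) (@Algebra.add rightOp).
Proof.
by move=> p q r; apply: opact_inj => a; rewrite !(opact_mul, opact_add).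
Qed.

HB.instance Definition _ := isDistributive.Build rightOp opmulDl opmulDr.

Lemma opcls_sum g : opcls g = fcs_sum (fun t => opgen t.1 t.2) g.
Proof.
elim/fcs_ind: g => [[al x]|g h IHg IHh]; first by rewrite fcs_sum_gen.
by rewrite fcs_sumD -IHg -IHh -opcls_add.
Qed.

Lemma opact_gen a al x : opact a (opgen al x) = gmul a al x.
Proof. by rewrite opact_cls /formal_act fcs_sum_gen. Qed.

Lemma opgen_mul al x be y :
  (opgen al x * opgen be y)%g = opgen al (gmul x be y).
Proof.
by apply: opact_inj => a; rewrite opact_mul !opact_gen gmulA.
Qed.

Definition is_right_unity (u : rightOp) := forall a, opact a u = a.

Definition has_right_unity := exists u, is_right_unity u.

Definition is_left_unity (e : freeCSemigroup (S * Gam)%type) :=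
  forall a, fcs_sum (fun t => gmul t.1 t.2 a) e = a.

Definition has_left_unity := exists e, is_left_unity e.

End RightOperatorSemiring.

Section Fuzzy.
Variable K : realType.

Definition fuzzy_subset (X : Type) (mu : X -> K) := forall x, 0 <= mu x <= 1.

Definition gs_fuzzy_ideal (S : gammaSemiring) (mu : S -> K) :=
  [/\ fuzzy_subset mu,
      forall a b, Num.min (mu a) (mu b) <= mu (a + b),
      forall a al b, mu a <= mu (gmul a al b)
    & forall a al b, mu b <= mu (gmul a al b)].

Definition fuzzy_ideal (R : zerolessSemiringType) (mu : R -> K) :=
  [/\ fuzzy_subset mu,
      forall p q, Num.min (mu p) (mu q) <= mu (p + q),
      forall p q, mu p <= mu (p * q)%g
    & forall p q, mu q <= mu (p * q)%g].

Definition k_condition (V : addSemigroupType) (mu : V -> K) :=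
  forall x y, Num.min (mu (x + y)) (mu y) <= mu x.

Definition gs_fuzzy_kideal (S : gammaSemiring) (mu : S -> K) :=
  gs_fuzzy_ideal mu /\ k_condition mu.

Definition fuzzy_kideal (R : zerolessSemiringType) (mu : R -> K) :=
  fuzzy_ideal mu /\ k_condition mu.

Definition fuzzy_to_op (S : gammaSemiring) (sigma : S -> K) :
    rightOp S -> K :=
  fun p => inf (range (fun a : S => sigma (opact a p))).

Definition fuzzy_of_op (S : gammaSemiring) (mu : rightOp S -> K) : S -> K :=
  fun a => inf (range (fun al : gs_gam S => mu (opgen al a))).

Lemma fuzzy_to_op_cls (S : gammaSemiring) (sigma : S -> K) g :
  fuzzy_to_op sigma (opcls g) =
  inf (range (fun a : S => sigma (fcs_sum (fun p => gmul a p.1 p.2) g))).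
Proof.
rewrite /fuzzy_to_op.
suff -> : (fun a => sigma (opact a (opcls g))) =
          (fun a => sigma (formal_act a g)) by [].
by apply/funext => a; rewrite opact_cls.
Qed.

End Fuzzy.

(* Main.v *)
(* R acts on S on the right by additive maps, with a.(pq) = (a.p).q, and      *)
(* x |-> [al, x] is additive, with [be, a al b] = [be, a][al, b]. Hence each  *)
(* inequality defining a fuzzy k-ideal holds pointwise inside the infimum.    *)
(* The one exception is mu(p) <= mu(pq) for mu the transform of sigma, which  *)
(* needs sigma(b) <= sigma(b.q): b.q is a sum of products with left factor b. *)

Require Import Defs.
From mathcomp Require Import all_boot all_order all_algebra reals.
From mathcomp Require Import classical_sets.

Set Implicit Arguments.
Unset Strict Implicit.
Unset Printing Implicit Defensive.

Import Order.TTheory.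
Local Open Scope ring_scope.

(** Both transforms are infima of nonempty families in [0,1], indexed by S or by [gs_gam S]. The sum
    inequality and the k-condition share the shape min(f,g) <= h, which passes to infima by
    [min_inf_range_le]. The product inequalities compare a term of one family with a term of the
    other, possibly at a different index. *)

Section InfRange.
Variables (K : realType) (I : Type) (f : I -> K).

(** Nonnegativity bounds the range below; without a lower bound, [inf] would be a default value. *)
Lemma inf_range_le i : (forall j, 0 <= f j) -> inf (range f) <= f i.
Proof.
by move=> f_ge0; apply: ge_inf; [exists 0 => _ [j _ <-] | exists i].
Qed.

Lemma le_inf_range (c : K) :
  inhabited I -> (forall i, c <= f i) -> c <= inf (range f).
Proof.
case=> i cf; apply: lb_le_inf; first by exists (f i), i.
by move=> _ [j _ <-].
Qed.

Lemma fuzzy_inf_range :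
  inhabited I -> fuzzy_subset f -> 0 <= inf (range f) <= 1.
Proof.
move=> I_inh f01; have f_ge0 j : 0 <= f j by case/andP: (f01 j).
rewrite le_inf_range //=; case: I_inh => i.
by apply: le_trans (inf_range_le i f_ge0) _; case/andP: (f01 i).
Qed.

End InfRange.

Lemma min_inf_range_le (K : realType) (I : Type) (f g h : I -> K) :
    inhabited I -> (forall i, 0 <= f i) -> (forall i, 0 <= g i) ->
    (forall i, Num.min (f i) (g i) <= h i) ->
  Num.min (inf (range f)) (inf (range g)) <= inf (range h).
Proof.
move=> I_inh f_ge0 g_ge0 fgh; apply: le_inf_range => // i.
by apply: le_trans (fgh i); apply: le_min2; apply: inf_range_le.
Qed.

Lemma opgenD (S : gammaSemiring) al (a b : S) :
  opgen al (a + b) = opgen al a + opgen al b.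
Proof.
by apply: opact_inj => c; rewrite opact_add !opact_gen gmulDr.
Qed.

(** Induction on a formal sum representing p: there is no empty sum, so the base case is a single
    product with left factor a. Values at least [sigma a] are preserved by sums. *)
Lemma gs_fuzzy_ideal_opact (K : realType) (S : gammaSemiring) (sigma : S -> K) :
  gs_fuzzy_ideal sigma -> forall a p, sigma a <= sigma (opact a p).
Proof.
case=> _ sigmaD sigmaM _ a p; rewrite /opact /formal_act.
elim/fcs_ind: (oprepr p) => [t|g h IHg IHh]; first by rewrite fcs_sum_gen.
by rewrite fcs_sumD; apply: le_trans (sigmaD _ _); rewrite le_min IHg.
Qed.

Lemma fuzzy_to_op_kideal (K : realType) (S : gammaSemiring) (sigma : S -> K) :
  gs_fuzzy_kideal sigma -> fuzzy_kideal (fuzzy_to_op sigma).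
Proof.
case=> sigmaI sigmak; have sigma_act := gs_fuzzy_ideal_opact sigmaI.
have [sigma01 sigmaD _ _] := sigmaI.
have sigma_ge0 a : 0 <= sigma a by case/andP: (sigma01 a).
have S_inh := gs_car_inh S.
split; first split.
- by move=> p; apply: fuzzy_inf_range => // a; apply: sigma01.
- by move=> p q; apply: min_inf_range_le => // a; rewrite opact_add.
- move=> p q; apply: le_inf_range => // a; rewrite opact_mul.
  by apply: le_trans (sigma_act _ _); apply: inf_range_le.
- move=> p q; apply: le_inf_range => // a; rewrite opact_mul.
  (* The term at index a is sigma((a.p).q), the member at b = a.p of the family defining the
     transform at q. *)
  exact: (@inf_range_le _ _ (fun b => sigma (opact b q))).
by move=> p q; apply: min_inf_range_le => // a; rewrite opact_add.
Qed.

Lemma fuzzy_of_op_kideal (K : realType) (S : gammaSemiring)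
    (mu : rightOp S -> K) :
  fuzzy_kideal mu -> gs_fuzzy_kideal (fuzzy_of_op mu).
Proof.
case=> [[mu01 muD muMl muMr] muk].
have mu_ge0 p : 0 <= mu p by case/andP: (mu01 p).
have Gam_inh := gs_gam_inh S.
split; first split.
- by move=> a; apply: fuzzy_inf_range => // al; apply: mu01.
- by move=> a b; apply: min_inf_range_le => // al; rewrite opgenD.
- move=> a al b; apply: le_inf_range => // be; rewrite -opgen_mul.
  by apply: le_trans (muMl _ _); apply: inf_range_le.
- move=> a al b; apply: le_inf_range => // be; rewrite -opgen_mul.
  apply: le_trans (muMr _ _).
  (* The right factor [al, b] does not depend on [be]: it is the member of the family of b at index
     [al]. *)
  exact: (@inf_range_le _ _ (fun ga => mu (opgen ga b))).
by move=> a b; apply: min_inf_range_le => // al; rewrite opgenD.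
Qed.

Theorem proposition3p9 (K : realType) (S : gammaSemiring)
    (hleft : has_left_unity S) (hright : has_right_unity S) :
  (forall sigma : S -> K,
     gs_fuzzy_kideal sigma -> fuzzy_kideal (fuzzy_to_op sigma)) /\
  (forall mu : rightOp S -> K,
     fuzzy_kideal mu -> gs_fuzzy_kideal (fuzzy_of_op mu)).
Proof.
by split; [apply: fuzzy_to_op_kideal | apply: fuzzy_of_op_kideal].
Qed.
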